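(* Let $g\in\mathbb K[S,S^{-1}]$, let $\{p_n\}_{n\ge0}$ be the associated monic eigenbasis of $\mathbb K[x]$, and let $h(D)=(1+D)g(D)=Sg(S)$ have Taylor expansion $h(D)=\sum_{k\ge0}h_kD^k$ at $D=0$. For every $n\ge0$, $$xp_n=p_{n+1}+(n-h_0)p_n-\sum_{k=1}^{n}h_k\,n^{\underline k}\,p_{n-k}.$$ Consequently, the lower bandwidth of $\{p_n\}$ is finite if and only if $g(S)\in S^{-1}\mathbb K[S]$. More precisely, suppose $g\neq0$ and write $g(S)=\sum_{j=p}^{q}c_jS^j$ with $c_pc_q\ne0$. (a) If $p<-1$, the lower bandwidth is infinite. (b) If $p\ge-1$ and $q=-1$, the lower bandwidth is zero and $xp_n=p_{n+1}+(n-c_{-1})p_n$. (c) If $p\ge-1$ and $q\ge0$, the lower bandwidth is exactly $q+1$. The coefficient of the extreme term $p_{n-q-1}$ in $xp_n$ is $-c_q\,n^{\underline{q+1}}$, which is nonzero for $n\ge q+1$.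
   Context: $\mathbb K$ is a field of characteristic zero. $S$ acts on $\mathbb K[x]$ by $(Sf)(x)=f(x+1)$; $D=S-1$, $X=xS^{-1}$. A Laurent polynomial $g\in\mathbb K[S,S^{-1}]=\mathbb K[D,(1+D)^{-1}]$ is written $g(S)$ or $g(D)$ via $S=1+D$, and expanded in $\mathbb K[[D]]$ at $D=0$. The monic eigenbasis associated with $g$ is $p_n=\exp(G(D))\,x^{\underline n}$, $n\ge 0$, where $G\in D\mathbb K[[D]]$ satisfies $G'=g$; equivalently, for any $\lambda\in\mathbb K$, $p_n$ is the unique monic degree-$n$ eigenpolynomial of $H=2(X+g)D-\lambda$ with eigenvalue $2n-\lambda$. Here $x^{\underline n}=x(x-1)\cdots(x-n+1)$, and for integers $n^{\underline k}=n(n-1)\cdots(n-k+1)$, $n^{\underline0}=1$. The (uniform) lower bandwidth of $\{p_n\}$ is the least integer $r\ge0$ such that $xp_n\in\operatorname{span}\{p_{n+1},p_n,\ldots,p_{n-r}\}$ for every $n\ge0$ (with $p_j=0$ for $j<0$); it is infinite if no such $r$ exists. *)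

(* Defs.v *)
From mathcomp Require Import all_boot all_order all_algebra.
From mathcomp Require Import finmap.
Set Implicit Arguments.
Unset Strict Implicit.
Unset Printing Implicit Defensive.
Import Order.TTheory GRing.Theory Num.Theory.
Local Open Scope ring_scope.

(* Formal power series in D over K: a k is the coefficient of D^k.
   They are compared coefficientwise. *)
Notation series K := (nat -> K) (only parsing).

Section Series.
Variable K : fieldType.
Implicit Types a b : series K.

Definition ser1 : series K := fun k => (k == 0%N)%:R.

Definition ser_mul a b : series K :=
  fun k => \sum_(i < k.+1) a i * b (k - i)%N.

Definition ser_pow a m : series K := iter m (ser_mul a) ser1.

Definition ser_deriv a : series K := fun k => a k.+1 *+ k.+1.

(* The antiderivative with zero constant term (see ser_primitiveK). *)
Definition ser_primitive a : series K :=
  fun k => if k is k'.+1 then a k' / k%:R else 0.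

(* exp a = \sum_m a^m / m!, for a with zero constant term: a^m then has no
   coefficient below D^m, so only m <= k contribute to the coefficient of D^k. *)
Definition ser_exp a : series K :=
  fun k => \sum_(m < k.+1) ser_pow a m k / (m`!)%:R.

(* S = 1 + D and S^-1 = (1 + D)^-1 (see serS_V) as series in D. *)
Definition serS : series K := fun k => (k <= 1)%N%:R.
Definition serSV : series K := fun k => (-1) ^+ k.

Definition serSz (j : int) : series K :=
  match j with
  | Posz m => ser_pow serS m
  | Negz m => ser_pow serSV m.+1
  end.

Lemma serS_V k : ser_mul serS serSV k = ser1 k.
Proof.
rewrite /ser_mul /ser1 /serS /serSV big_ord_recl /= subn0 mul1r.
case: k => [|k]; first by rewrite big_ord0 addr0.
rewrite big_ord_recl /= big1 ?addr0; last by move=> i _; rewrite mul0r.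
by rewrite /bump /= subSS subn0 mul1r exprS mulN1r addNr.
Qed.

Lemma ser_primitiveK (K0 : [pchar K] =i pred0) a k :
  ser_deriv (ser_primitive a) k = a k.
Proof.
rewrite /ser_deriv /ser_primitive -[LHS]mulr_natr divfK //.
by rewrite (pcharf0P K).1.
Qed.

End Series.

(* g j is the coefficient of S^j. *)
Definition laurent (K : fieldType) := {fsfun int -> K with 0}.

Section Eigenbasis.
Variable K : fieldType.
Implicit Types (g : laurent K) (f : {poly K}).

(* The expansion at D = 0 of g(1 + D). *)
Definition laurent_series g : series K :=
  fun k => \sum_(j <- finsupp g) g j * serSz K j k.

Definition laurent_of_poly_coef (P : {poly K}) (j : int) : K :=
  if j is Posz m then P`_m else 0.

(* g(S) = S^-1 P(S) for some P: the coefficient of S^j in S^-1 P(S) is the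
   coefficient of S^(j + 1) in P(S). *)
Definition in_SV_poly g : Prop :=
  exists P : {poly K}, forall j : int, g j = laurent_of_poly_coef P (j + 1).

Definition shiftS f : {poly K} := f \Po ('X + 1).
Definition diffD f : {poly K} := shiftS f - f.

(* The action of the series a(D) on f; D lowers degrees, so D^k f = 0 for
   k >= size f. *)
Definition ser_act (a : series K) f : {poly K} :=
  \sum_(k < size f) a k *: iter k diffD f.

Definition falling n : {poly K} := \prod_(i < n) ('X - i%:R%:P).

Definition eigenbasis g (n : nat) : {poly K} :=
  ser_act (ser_exp (ser_primitive (laurent_series g))) (falling n).

End Eigenbasis.

Section Bandwidth.
Variable K : fieldType.
Implicit Types (p : nat -> {poly K}) (f : {poly K}).

(* x p_n lies in span {p_(n+1), ..., p_(n-r)}; the truncated n - r implements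
   the convention p_j = 0 for j < 0. *)
Definition lower_banded p (r : nat) : Prop :=
  forall n : nat, exists c : nat -> K,
    'X * p n = \sum_((n - r)%N <= j < n.+2) c j *: p j.

Definition lower_bandwidth p (r : nat) : Prop :=
  lower_banded p r /\ forall r', lower_banded p r' -> (r <= r')%N.

Definition lower_bandwidth_infinite p : Prop := forall r, ~ lower_banded p r.

Definition lower_bandwidth_finite p : Prop := exists r, lower_bandwidth p r.

Definition expansion p f (s : seq K) : Prop :=
  f = \sum_(i < size s) s`_i *: p i.

(* f is a finite linear combination of the p_i, and its coefficient on p_j is
   well defined and equal to c. *)
Definition coef_on p f (j : nat) (c : K) : Prop :=
  (exists s, expansion p f s) /\ forall s, expansion p f s -> s`_j = c.

End Bandwidth.

(* Main.v *)
(* Put e = exp G, so p_n = e(D) x^{\underline n}. The commutator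
   [e(D), x] is S e'(D) = S g(D) e(D) = h(D) e(D), applied to x^{\underline n},
   gives the recurrence. As the p_n are linearly independent and
   n^{\underline k} <> 0 for k <= n, lower bandwidth at most r means h_k = 0 for
   all k > r, i.e. h = S g(S) is a polynomial in D = S - 1 of degree at most r. *)
Require Import Defs.
From mathcomp Require Import all_boot all_order all_algebra.
From mathcomp Require Import finmap ring zify.
Set Implicit Arguments.
Unset Strict Implicit.
Unset Printing Implicit Defensive.
Import Order.TTheory GRing.Theory Num.Theory.
Local Open Scope ring_scope.

(** * Power series through polynomial truncations, and the exponential *)

Section Series.
Variable K : fieldType.
Implicit Types (a b c : nat -> K) (A B C : {poly K}).

(** Agreement modulo [D^N]. It transports ring laws from [{poly K}] to series: coefficient [k] of a
    product only involves coefficients up to [k], so truncating at [k.+1] suffices. *)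
Definition agree_upto N a A := forall i, (i < N)%N -> a i = A`_i.

Lemma agree_trunc N a : agree_upto N a (\poly_(i < N) a i).
Proof. by move=> i ltiN; rewrite coef_poly ltiN. Qed.

Lemma agree_mul N a b A B :
  agree_upto N a A -> agree_upto N b B -> agree_upto N (ser_mul a b) (A * B).
Proof.
move=> aA bB k ltkN; rewrite coefM; apply: eq_bigr => i _.
by rewrite aA ?bB //; have := ltn_ord i; lia.
Qed.

Lemma agree_pow N a A m : agree_upto N a A -> agree_upto N (ser_pow a m) (A ^+ m).
Proof.
move=> aA; elim: m => [|m IHm]; first by move=> i _; rewrite expr0 coef1.
by rewrite exprS; apply: agree_mul.
Qed.

Lemma ser_mulA a b c k :
  ser_mul a (ser_mul b c) k = ser_mul (ser_mul a b) c k.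
Proof.
have tr d := @agree_trunc k.+1 d.
rewrite (agree_mul (tr a) (agree_mul (tr b) (tr c)) (ltnSn k)).
by rewrite (agree_mul (agree_mul (tr a) (tr b)) (tr c) (ltnSn k)) mulrA.
Qed.

Lemma eq_ser_mul a a' b b' : a =1 a' -> b =1 b' -> ser_mul a b =1 ser_mul a' b'.
Proof. by move=> eqa eqb k; apply: eq_bigr => i _; rewrite eqa eqb. Qed.

Lemma ser_mul1 b : ser_mul (@ser1 K) b =1 b.
Proof.
move=> k; rewrite /ser_mul big_ord_recl /= subn0 mul1r big1 ?addr0 // => i _.
by rewrite /ser1 mul0r.
Qed.

Lemma ser_mulS b k :
  ser_mul (@serS K) b k = b k + (if k is k'.+1 then b k' else 0).
Proof.
rewrite /ser_mul big_ord_recl /= subn0 mul1r; congr (_ + _).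
case: k => [|k]; first by rewrite big_ord0.
rewrite big_ord_recl /= big1 ?addr0; last by move=> i _; rewrite mul0r.
by rewrite mul1r subSS subn0.
Qed.

Lemma ser_mulS_poly b B :
  (forall k, b k = B`_k) -> forall k, ser_mul (@serS K) b k = (('X + 1) * B)`_k.
Proof.
move=> bB k; rewrite ser_mulS mulrDl mul1r coefD coefXM bB addrC.
by case: k => [|k] //=; rewrite bB.
Qed.

Lemma serSz_Posz m k : serSz K m%:Z k = (('X + 1) ^+ m)`_k.
Proof.
elim: m k => [|m IHm] k; first by rewrite expr0 coef1.
by rewrite exprS -(ser_mulS_poly IHm).
Qed.

Lemma serS_mul_serSz j k : ser_mul (@serS K) (serSz K j) k = serSz K (j + 1) k.
Proof.
case: j => n; first by rewrite -PoszD addn1.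
rewrite [serSz _ _]/(ser_mul _ (ser_pow _ n)) ser_mulA.
rewrite (eq_ser_mul (@serS_V K) (frefl _)) ser_mul1.
(* [Negz n] is -(n+1), so n = 0 lands on [S^0], in the [Posz] branch. *)
by case: n => [|n] //; rewrite (_ : Negz n.+1 + 1 = Negz n) //; lia.
Qed.

Hypothesis K0 : [pchar K] =i pred0.

Lemma char0_natf_eq0 n : (n%:R == 0 :> K) = (n == 0)%N.
Proof. by rewrite (pcharf0P K).1. Qed.

Definition exp_trunc A n : {poly K} := \sum_(m < n.+1) (m`!%:R)^-1 *: A ^+ m.

(** Since m/m! = 1/(m-1)!, differentiation shifts the terms down by one, so the truncation order
    drops by one. *)
Lemma exp_trunc_deriv A n : (exp_trunc A n.+1)^`() = A^`() * exp_trunc A n.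
Proof.
rewrite /exp_trunc big_ord_recl derivD expr0 linearZ /= derivC scaler0 add0r.
rewrite raddf_sum mulr_sumr; apply: eq_bigr => i _ /=.
rewrite derivZ deriv_exp /= -scaler_nat !scalerA -scalerAr; congr (_ *: _).
rewrite factS natrM invfM mulrC mulrA divff ?mul1r //.
by rewrite char0_natf_eq0.
Qed.

(** As [A] has no constant term, [A ^+ m] has no coefficient below [D^m]. Hence the cutoff of
    [ser_exp], which varies with the coefficient, can be replaced by the fixed cutoff [n]. *)
Lemma agree_exp a A n :
  a 0%N = 0 -> agree_upto n.+1 a A -> agree_upto n.+1 (ser_exp a) (exp_trunc A n).
Proof.
move=> a0 aA i lein.
have A0 : A`_0 = 0 by rewrite -aA.
have powA m k : (k < m)%N -> (A ^+ m)`_k = 0.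
  elim: m k => // m IHm k ltkm; rewrite exprS coefM big1 // => -[[|j] lejk] _ /=.
    by rewrite A0 mul0r.
  by rewrite IHm ?mulr0 //; lia.
rewrite /exp_trunc coef_sum /ser_exp.
rewrite (big_ord_widen n.+1 (fun m => ser_pow a m i / m`!%:R)) //.
rewrite big_mkcond; apply: eq_bigr => m _; rewrite coefZ -(agree_pow m aA) // mulrC.
by case: ltnP => // ltim; rewrite (agree_pow m aA) // powA // mulr0.
Qed.

Lemma ser_exp_deriv a k :
  a 0%N = 0 ->
  ser_deriv (ser_exp a) k = ser_mul (ser_deriv a) (ser_exp a) k.
Proof.
(* Coefficient [k] of the derivative involves coefficient [k.+1] of the exponential, hence the bound
   [k.+2]. *)
move=> a0; pose A := \poly_(i < k.+2) a i.
have aA : agree_upto k.+2 a A by apply: agree_trunc.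
rewrite /ser_deriv (agree_exp a0 aA (ltnSn k.+1)) -coef_deriv exp_trunc_deriv.
symmetry; apply: (@agree_mul k.+1) => // [i ltik|].
  by rewrite coef_deriv -aA.
by apply: agree_exp => // i ltik; rewrite aA // ltnW.
Qed.
End Series.

(** * Series in [D] acting on falling factorials *)

Section Falling.
Variable K : fieldType.
Implicit Types a b : nat -> K.

(** Closed form of a(D) on the falling factorial of degree [n] (see [ser_act_falling]). *)
Definition fallcomb a n : {poly K} :=
  \sum_(k < n.+1) (a k * (n ^_ k)%:R) *: falling K (n - k).

Lemma size_falling n : size (falling K n) = n.+1.
Proof. by rewrite /falling size_prod_XsubC /index_enum -enumT size_enum_ord. Qed.

Lemma fallingS n : falling K n.+1 = falling K n * ('X - n%:R%:P).
Proof. by rewrite /falling big_ord_recr. Qed.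

Lemma shiftS_fallingS n : shiftS (falling K n.+1) = ('X + 1) * falling K n.
Proof.
rewrite /shiftS /falling rmorph_prod big_ord_recl /=; congr (_ * _).
  by rewrite comp_polyB comp_polyX comp_polyC subr0.
apply: eq_bigr => i _; rewrite comp_polyB comp_polyX comp_polyC.
by rewrite /bump /= natrD polyCD; ring.
Qed.

Lemma diffD_falling n : diffD (falling K n) = n%:R *: falling K n.-1.
Proof.
case: n => [|n].
  by rewrite scale0r /diffD /shiftS /falling big_ord0 comp_polyC subrr.
rewrite /diffD shiftS_fallingS fallingS -mul_polyC /= -natr1 polyCD; ring.
Qed.

Lemma diffDZ c (f : {poly K}) : diffD (c *: f) = c *: diffD f.
Proof. by rewrite /diffD /shiftS comp_polyZ scalerBr. Qed.

Lemma iter_diffD_falling k n :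
  iter k (@diffD K) (falling K n) = (n ^_ k)%:R *: falling K (n - k).
Proof.
elim: k => [|k IHk]; first by rewrite ffactn0 scale1r subn0.
by rewrite iterS IHk diffDZ diffD_falling scalerA -natrM ffactnSr subnS.
Qed.

Lemma ser_act_falling a n : ser_act a (falling K n) = fallcomb a n.
Proof.
rewrite /ser_act size_falling; apply: eq_bigr => k _.
by rewrite iter_diffD_falling scalerA.
Qed.

Lemma size_fallcomb a n : a 0%N = 1 -> size (fallcomb a n) = n.+1.
Proof.
move=> a0; rewrite /fallcomb big_ord_recl a0 mul1r ffactn0 scale1r subn0.
rewrite size_polyDl size_falling // ltnS.
apply: (leq_trans (size_sum _ _ _)); apply/bigmax_leqP => i _.
rewrite (leq_trans (size_scale_leq _ _)) // size_falling lift0.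
by have := ltn_ord i; lia.
Qed.

(** The Cauchy product acts as a composition: sum over s = k + l and use
    [n ^_ (k + l) = n ^_ k * (n - k) ^_ l]. *)
Lemma fallcomb_mul a b n :
  fallcomb (ser_mul a b) n =
  \sum_(k < n.+1) (a k * (n ^_ k)%:R) *: fallcomb b (n - k).
Proof.
have ffactD k l : (n ^_ (k + l) = n ^_ k * (n - k) ^_ l)%N.
  by elim: l => [|l IHl]; rewrite ?addn0 ?muln1 // addnS !ffactnSr IHl subnDA mulnA.
pose G k s := (a k * b (s - k)%N * (n ^_ s)%:R) *: falling K (n - s).
transitivity (\sum_(0 <= s < n.+1) \sum_(0 <= k < n.+1 | (k <= s)%N) G k s).
  rewrite big_mkord; apply: eq_bigr => s _.
  rewrite big_mkord mulr_suml scaler_suml.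
  by rewrite (big_ord_widen n.+1 (fun k => G k s)) // ltnS -ltnS.
rewrite (exchange_big_dep_nat xpredT) //= big_mkord; apply: eq_bigr => k _.
transitivity (\sum_(0 + k <= s < n.+1) G k s).
  by rewrite [RHS](big_nat_widenl _ 0).
rewrite big_addn subSn -1?ltnS // big_mkord /fallcomb scaler_sumr; apply: eq_bigr => l _.
by rewrite /G addnK addnC ffactD subnDA scalerA natrM mulrACA.
Qed.

Lemma mulX_falling n : 'X * falling K n = falling K n.+1 + n%:R *: falling K n.
Proof. by rewrite fallingS -mul_polyC; ring. Qed.

(* On falling factorials this is the commutator [a(D), x] = S a'(D). *)
Lemma mulX_fallcomb a n :
  'X * fallcomb a n =
  fallcomb a n.+1 + n%:R *: fallcomb a n
  - fallcomb (ser_mul (@serS K) (ser_deriv a)) n.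
Proof.
(* As S = 1 + D, [S a'] splits into [a'], which gives the terms [v], and [D a'], which gives the
   terms [u]. *)
pose u k := (k%:R * a k * (n ^_ k)%:R) *: falling K (n - k).
pose v k := (a k.+1 * k.+1%:R * (n ^_ k)%:R) *: falling K (n - k).
have -> : fallcomb (ser_mul (@serS K) (ser_deriv a)) n =
          \sum_(k < n.+1) v k + \sum_(k < n.+1) u k.
  rewrite -big_split; apply: eq_bigr => -[k /= lek] _.
  rewrite ser_mulS -scalerDl -mulrDl /ser_deriv [_ * k.+1%:R]mulr_natr.
  congr ((_ + _) * _ *: _).
  by case: k lek => [|k] _; rewrite ?mul0r ?mulr_natl.
(* The Pascal-type rule [ffactS] splits off the same sum of [v], which then cancels. *)
have -> : fallcomb a n.+1 =
   \sum_(k < n.+1) (a k * (n ^_ k)%:R) *: falling K (n - k).+1 + \sum_(k < n.+1) v k.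
  have ffactS k : (n.+1 ^_ k = n ^_ k + k * n ^_ k.-1)%N.
    elim: k => // k IHk; rewrite ffactnSr IHk ffactnSr /=.
    case: k IHk => [|k] _; first by rewrite /= !ffactn0; lia.
    rewrite /= ffactnSr subSS subnS; move: (n ^_ k) (n - k)%N => c [|d]; nia.
  transitivity (\sum_(k < n.+2) (a k * (n ^_ k)%:R) *: falling K (n.+1 - k)
    + \sum_(k < n.+2) (a k * k%:R * (n ^_ k.-1)%:R) *: falling K (n.+1 - k)).
    rewrite -big_split; apply: eq_bigr => k _.
    by rewrite ffactS natrD natrM mulrDr scalerDl mulrA.
  congr (_ + _).
    rewrite big_ord_recr /= ffact_small // mulr0 scale0r addr0.
    by apply: eq_bigr => k _; rewrite subSn // -ltnS.
  rewrite big_ord_recl /= mulr0 mul0r scale0r add0r.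
  by apply: eq_bigr => k _; rewrite /v subSS.
rewrite [X in X - _]addrAC opprD addrA addrK.
rewrite /fallcomb mulr_sumr scaler_sumr -!addrA.
(* What remains holds term by term: multiplying the falling factorial of degree n-k by x raises it
   and adds (n-k) times itself; the part -k is supplied by [u]. *)
rewrite -sumrN -!big_split /=; apply: eq_bigr => -[k /= lek] _.
rewrite -scalerAr mulX_falling scalerDr; congr (_ + _).
rewrite !scalerA -scaleNr -scalerDl; congr (_ *: _).
rewrite natrB; last by rewrite -ltnS.
by rewrite mulrBr mulrAC [_ * n%:R]mulrC mulrA [k%:R * _]mulrC [_ * k%:R]mulrAC.
Qed.

End Falling.

(** * The recurrence for the eigenbasis *)

Section Eigenbasis.
Variable K : fieldType.
Hypothesis K0 : [pchar K] =i pred0.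
Variable g : laurent K.
Local Notation P := (eigenbasis g).
Local Notation h := (ser_mul (@serS K) (laurent_series g)).

Lemma eigenbasis_recurrence n :
  'X * P n = P n.+1 + n%:R *: P n
             - \sum_(k < n.+1) (h k * (n ^_ k)%:R) *: P (n - k)%N.
Proof.
set e := ser_exp (ser_primitive (laurent_series g)).
have PE m : P m = fallcomb e m by rewrite /eigenbasis ser_act_falling.
rewrite PE mulX_fallcomb -!PE; congr (_ - _).
transitivity (fallcomb (ser_mul h e) n); last first.
  by rewrite fallcomb_mul; apply: eq_bigr => k _; rewrite PE.
(* After reassociation to S(ge), it remains to see e' = G'e = ge. *)
apply: eq_bigr => k _; rewrite -ser_mulA; congr (_ * _ *: _).
apply: eq_ser_mul => // i; rewrite ser_exp_deriv //.
by apply: eq_ser_mul => // j; rewrite ser_primitiveK.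
Qed.

Lemma size_eigenbasis n : size (P n) = n.+1.
Proof.
rewrite /eigenbasis ser_act_falling size_fallcomb //.
by rewrite /ser_exp big_ord1 divr1.
Qed.
End Eigenbasis.

(** * Uniqueness of expansions in polynomials of exact degrees *)

Section Expansion.
Variables (K : fieldType) (p : nat -> {poly K}).
Hypothesis size_p : forall n, size (p n) = n.+1.

(** Only the last polynomial reaches the top degree, so its coefficient vanishes; then induct. *)
Lemma lincomb_eq0 N (c : nat -> K) :
  \sum_(i < N) c i *: p i = 0 -> forall i, (i < N)%N -> c i = 0.
Proof.
elim: N => // N IHN; rewrite big_ord_recr /= => sum0.
have cN : c N = 0.
  have : (\sum_(i < N) c i *: p i + c N *: p N)`_N = 0 by rewrite sum0 coef0.
  rewrite coefD coefZ nth_default ?add0r; last first.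
    apply: (leq_trans (size_sum _ _ _)); apply/bigmax_leqP => i _.
    by rewrite (leq_trans (size_scale_leq _ _)) // size_p.
  move/eqP; rewrite mulf_eq0 => /orP[/eqP // |].
  have -> : (p N)`_N = lead_coef (p N) by rewrite lead_coefE size_p.
  by rewrite lead_coef_eq0 -size_poly_eq0 size_p.
move: sum0; rewrite cN scale0r addr0 => /IHN c0 i.
by rewrite ltnS leq_eqVlt => /predU1P[-> // | /c0].
Qed.

Lemma lincomb_inj N (c d : nat -> K) :
  \sum_(i < N) c i *: p i = \sum_(i < N) d i *: p i ->
  forall i, (i < N)%N -> c i = d i.
Proof.
move=> eqcd i ltiN; apply/eqP; rewrite -subr_eq0; apply/eqP.
apply: (@lincomb_eq0 N (fun j => c j - d j)) => //.
under eq_bigr => j _ do rewrite scalerBl.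
by rewrite sumrB eqcd subrr.
Qed.

Lemma coef_on_lincomb N (d : nat -> K) f j :
  f = \sum_(i < N) d i *: p i -> (j < N)%N -> coef_on p f j (d j).
Proof.
move=> fE ltjN; split.
  exists (mkseq d N); rewrite /expansion size_mkseq fE.
  by apply: eq_bigr => i _; rewrite nth_mkseq.
(* The two expansions may differ in length; both are padded with zeros to length [M]. *)
move=> s fs; pose M := maxn N (size s).
pose d' i := if (i < N)%N then d i else 0.
have -> : d j = d' j by rewrite /d' ltjN.
apply: (@lincomb_inj M) => //; last by rewrite /M; lia.
transitivity f.
  rewrite fs [in RHS](big_ord_widen M (fun i => s`_i *: p i)) ?leq_maxr // [RHS]big_mkcond.
  by apply: eq_bigr => i _; case: ltnP => // lesi; rewrite nth_default // scale0r.
rewrite fE [in LHS](big_ord_widen M (fun i => d i *: p i)) ?leq_maxl // big_mkcond.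
by apply: eq_bigr => i _; rewrite /d'; case: ifP => //; rewrite scale0r.
Qed.

(** Puts the banded sum of [lower_banded] into the form required by [lincomb_inj]. *)
Lemma big_nat_if m n (c : nat -> K) :
  \sum_(m <= i < n) c i *: p i =
  \sum_(i < n) (if (m <= i)%N then c i else 0) *: p i.
Proof.
rewrite big_geq_mkord big_mkcond; apply: eq_bigr => i _ /=.
by case: ifP => //; rewrite scale0r.
Qed.
End Expansion.

(** * Bandwidth and the coefficients of h *)

Section LowerBandwidth.
Variable K : fieldType.
Hypothesis K0 : [pchar K] =i pred0.
Variable g : laurent K.
Local Notation P := (eigenbasis g).
Local Notation h := (ser_mul (@serS K) (laurent_series g)).

(** The guard [j <= n] matters: at [j = n.+1] the truncated [n - j] is 0 and would wrongly
    contribute [h 0]. *)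
Definition recurrence_coef n j : K :=
  (j == n.+1)%:R + (j == n)%:R * n%:R
  - (if (j <= n)%N then h (n - j)%N * (n ^_ (n - j))%:R else 0).

Lemma mulX_eigenbasis n :
  'X * P n = \sum_(j < n.+2) recurrence_coef n j *: P j.
Proof.
rewrite eigenbasis_recurrence // /recurrence_coef.
under [RHS]eq_bigr => j _ do rewrite scalerBl scalerDl.
rewrite sumrB big_split /=; congr (_ + _ - _).
- rewrite big_ord_recr /= eqxx scale1r big1 ?add0r // => i _.
  by rewrite ltn_eqF ?scale0r.
- rewrite big_ord_recr /= big_ord_recr /= eqxx mul1r big1 ?add0r => [|i _].
    by rewrite gtn_eqF // mul0r scale0r addr0.
  by rewrite ltn_eqF ?mul0r ?scale0r.
- rewrite [RHS]big_ord_recr /= ltnn scale0r addr0.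
  rewrite (reindex_inj rev_ord_inj) /=; apply: eq_bigr => -[j /= lej] _.
  by rewrite subSS -ltnS lej subKn.
Qed.

Lemma lower_bandedP r : lower_banded P r <-> forall k, (r < k)%N -> h k = 0.
Proof.
split=> [bandr k ltrk | h0 n].
  (* Take n = k and the coefficient of p_0, which is outside the band since r < k. It equals -h_k
     k!, and k! is nonzero in characteristic zero. *)
  have [c] := bandr k; rewrite mulX_eigenbasis big_nat_if.
  pose c' j := if (k - r <= j)%N then c j else 0.
  move=> /(lincomb_inj (size_eigenbasis g) (d := c'))/(_ 0%N isT).
  rewrite /c' leqn0 subn_eq0 leqNgt ltrk /=.
  rewrite /recurrence_coef subn0 ffactnn (_ : 0%N == k = false) ?mul0r ?addr0; last by lia.
  rewrite add0r => /eqP; rewrite oppr_eq0 mulf_eq0 char0_natf_eq0 //.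
  by rewrite -leqn0 leqNgt fact_gt0 orbF => /eqP.
exists (recurrence_coef n); rewrite mulX_eigenbasis big_nat_if.
apply: eq_bigr => j _; case: leqP => // ltj.
rewrite /recurrence_coef h0; last by lia.
rewrite mul0r if_same subr0 !ltn_eqF ?mul0r ?addr0 //; lia.
Qed.

(* The expansion at D = 0 of S^t g(S). *)
Definition shifted_series (t : int) k : K := \sum_(j <- finsupp g) g j * serSz K (j + t) k.

(** The variable stands for [D]. The absolute value only makes the exponent a natural number; it is
    harmless when j + t >= 0 on the support of [g]. *)
Definition shifted_poly (t : int) : {poly K} :=
  \sum_(j <- finsupp g) g j *: ('X + 1) ^+ `|(j + t)%R|%N.

Lemma serS_mul_shifted t k :
  ser_mul (@serS K) (shifted_series t) k = shifted_series (t + 1) k.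
Proof.
rewrite /shifted_series; under [RHS]eq_bigr => j _ do rewrite addrA -serS_mul_serSz ser_mulS mulrDr.
rewrite ser_mulS big_split; congr (_ + _).
by case: k => // ; rewrite big1 // => j; rewrite mulr0.
Qed.

Lemma serS_mul_laurent_series k : h k = shifted_series 1 k.
Proof.
rewrite -[1]add0r -serS_mul_shifted; apply: eq_ser_mul => // i.
by apply: eq_bigr => j _; rewrite addr0.
Qed.

Lemma shifted_seriesE t k :
  (forall j, g j != 0 -> 0 <= j + t) -> shifted_series t k = (shifted_poly t)`_k.
Proof.
move=> gt; rewrite /shifted_poly coef_sum.
apply: eq_big_seq => j; rewrite mem_finsupp => /gt jt.
by rewrite coefZ -serSz_Posz gez0_abs.
Qed.

Lemma sum_finsupp_pred1 j : \sum_(i <- finsupp g) (if i == j then g i else 0) = g j.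
Proof.
have [jg|] := boolP (j \in finsupp g).
  by rewrite (bigD1_seq j) ?fset_uniq //= eqxx big1 ?addr0 // => i /negPf ->.
rewrite memNfinsupp => /eqP gj0; rewrite big1 // => i _.
by case: eqP => [->|].
Qed.

(** Substituting D = S - 1 turns powers of 1 + D into powers of S, from which the coefficients of
    [g] are read off. *)
Lemma coef_shifted_poly t j :
  (forall j, g j != 0 -> 0 <= j + t) -> 0 <= j + t ->
  (shifted_poly t \Po ('X - 1))`_`|(j + t)%R| = g j.
Proof.
move=> gt jt; rewrite /shifted_poly raddf_sum /= coef_sum.
transitivity (\sum_(i <- finsupp g) if i == j then g i else 0).
  apply: eq_big_seq => i; rewrite mem_finsupp => /gt it.
  rewrite comp_polyZ rmorphXn /= comp_polyD comp_polyX -polyC1 comp_polyC subrK.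
  rewrite coefZ coefXn (_ : (`|(j + t)%R| == `|(i + t)%R|)%N = (i == j)); last by lia.
  by case: eqP; rewrite ?mulr1 ?mulr0.
exact: sum_finsupp_pred1.
Qed.

Lemma finsupp_bound : exists m : nat, forall j, g j != 0 -> 0 <= j + m.+1%:Z.
Proof.
exists (\sum_(j <- finsupp g) `|j|)%N => j; rewrite -mem_finsupp => jg.
have : (`|j| <= \sum_(i <- finsupp g) `|i|)%N by rewrite (big_rem j) ?leq_addr.
lia.
Qed.

(* If S g(S) is a polynomial H(D), multiplying by a high power S^m makes both
   sides polynomials in S: S^(m+1) g(S) = S^m H(S - 1), so S g(S) = H(S - 1). *)
Lemma in_SV_poly_of_series N : (forall k, (N <= k)%N -> h k = 0) -> in_SV_poly g.
Proof.
move=> h0; have [m gm] := finsupp_bound.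
pose H := \poly_(i < N) h i; have hH k : shifted_series 1 k = H`_k.
  by rewrite coef_poly -serS_mul_laurent_series; case: ltnP => // /h0.
have SH n k : shifted_series n.+1%:Z k = (('X + 1) ^+ n * H)`_k.
  elim: n k => [|n IHn] k; first by rewrite mul1r hH.
  by rewrite exprS -mulrA -(ser_mulS_poly IHn) serS_mul_shifted -PoszD addn1.
have eqH : shifted_poly m.+1%:Z = ('X + 1) ^+ m * H.
  by apply/polyP => k; rewrite -shifted_seriesE ?SH.
(* For j + m + 1 >= 0, compare coefficients of S^(j+m+1); the factor S^m forces zero when j + 1 < 0.
   For smaller j both sides vanish. *)
exists (H \Po ('X - 1)) => j; have [jm|jm] := leP 0 (j + m.+1%:Z).
  rewrite -(coef_shifted_poly gm jm) eqH rmorphM rmorphXn /=.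
  rewrite comp_polyD comp_polyX -polyC1 comp_polyC subrK coefXnM.
  rewrite /laurent_of_poly_coef; case: ltnP => [ltm|lem].
    by case E: (j + 1) => [n|//]; lia.
  case E: (j + 1) => [n|]; last by lia.
  by congr (_`_ _); lia.
have -> : g j = 0 by apply/eqP; apply: contraLR jm => /gm; rewrite -leNgt.
by case E: (j + 1) => [n|//]; lia.
Qed.

Lemma series_shifted_poly : (forall j, g j != 0 -> -1 <= j) ->
  forall k, h k = (shifted_poly 1)`_k.
Proof. by move=> ge k; rewrite serS_mul_laurent_series shifted_seriesE // => j /ge; lia. Qed.

Lemma in_SV_poly_ge : in_SV_poly g -> forall j, g j != 0 -> -1 <= j.
Proof.
move=> [A gA] j; rewrite gA; case E: (j + 1) => [n|n]; first by lia.
by rewrite eqxx.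
Qed.

Lemma lower_bandwidthP r :
  (forall k, (r < k)%N -> h k = 0) -> (r = 0%N \/ h r != 0) -> lower_bandwidth P r.
Proof.
move=> h0 hr; split; first exact/lower_bandedP.
move=> r' /lower_bandedP h'; case: hr => [-> //|hr]; rewrite leqNgt.
by apply: contra hr => /h' ->.
Qed.

(** A least bound is obtained from any bound by lowering it as long as the top coefficient of h
    vanishes. *)
Lemma lower_bandwidth_finiteP :
  lower_bandwidth_finite P <-> exists r, forall k, (r < k)%N -> h k = 0.
Proof.
split=> [[r [/lower_bandedP hr _]]|[r]]; first by exists r.
elim: r => [|r IHr] h0; first by exists 0%N; apply: lower_bandwidthP => //; left.
have [hr0|hr0] := eqVneq (h r.+1) 0.
  by apply: IHr => k; rewrite leq_eqVlt => /predU1P[<- //|/h0].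
by exists r.+1; apply: lower_bandwidthP => //; right.
Qed.

Lemma lower_bandwidth_finite_SV : lower_bandwidth_finite P <-> in_SV_poly g.
Proof.
rewrite lower_bandwidth_finiteP; split=> [[r h0]|/in_SV_poly_ge/series_shifted_poly hE].
  exact: (in_SV_poly_of_series h0).
by exists (size (shifted_poly 1)) => k ltk; rewrite hE nth_default // ltnW.
Qed.

(** For k >= q+1, the power (1+D)^(j+1) has degree at most k and is monic, so it contributes to D^k
    only when j + 1 = k. *)
Lemma series_top_coef q : (forall j, g j != 0 -> -1 <= j <= q) -> -1 <= q ->
  h `|(q + 1)%R|%N = g q /\ forall k, (`|(q + 1)%R| < k)%N -> h k = 0.
Proof.
move=> gpq q1; have hE : forall k, h k = (shifted_poly 1)`_k.
  by apply: series_shifted_poly => j /gpq /andP[].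
have coefXD n k : (n <= k)%N -> (('X + 1 : {poly K}) ^+ n)`_k = (k == n)%:R.
  have -> : 'X + 1 = 'X - (-1)%:P :> {poly K} by rewrite polyCN polyC1 opprK.
  have sz := size_exp_XsubC n (-1 : K).
  have /monicP mon : ('X - (-1 : K)%:P) ^+ n \is monic.
    by rewrite monic_exp ?monicXsubC.
  rewrite leq_eqVlt => /predU1P[<-|ltnk]; last first.
    by rewrite nth_default ?sz // gtn_eqF.
  by rewrite eqxx -[RHS]mon lead_coefE sz.
have coefh k : (`|(q + 1)%R| <= k)%N ->
    h k = \sum_(j <- finsupp g) if j == k%:Z - 1 then g j else 0.
  move=> leqk; rewrite hE /shifted_poly coef_sum.
  apply: eq_big_seq => j; rewrite mem_finsupp => /gpq /andP[j1 jq].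
  rewrite coefZ coefXD; last by lia.
  rewrite (_ : (k == `|(j + 1)%R|)%N = (j == k%:Z - 1)); last by lia.
  by case: eqP; rewrite ?mulr1 ?mulr0.
split=> [|k ltk].
  by rewrite coefh // sum_finsupp_pred1; congr (g _); lia.
rewrite coefh ?(ltnW ltk) // big_seq big1 // => j.
rewrite mem_finsupp => /gpq /andP[_ jq]; case: eqP => // E; lia.
Qed.
End LowerBandwidth.

(** * The recurrence, the finiteness criterion and the three cases *)

Theorem theorem5p3 (K : fieldType) (K0 : [pchar K] =i pred0) (g : laurent K) :
  let P := eigenbasis g in
  let h := ser_mul (@serS K) (laurent_series g) in
  [/\ forall n : nat,
        'X * P n = P n.+1 + (n%:R - h 0%N) *: P n
                   - \sum_(1 <= k < n.+1) (h k * (n ^_ k)%:R) *: P (n - k)%N,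
      lower_bandwidth_finite P <-> in_SV_poly g
    & forall p q : int,
        g p * g q != 0 ->
        (forall j : int, g j != 0 -> p <= j <= q) ->
        [/\ p < -1 -> lower_bandwidth_infinite P,
            -1 <= p -> q = -1 ->
              lower_bandwidth P 0 /\
              (forall n : nat,
                 'X * P n = P n.+1 + (n%:R - g (-1)) *: P n)
          & -1 <= p -> forall m : nat, q = m%:Z ->
              lower_bandwidth P m.+1 /\
              (forall n : nat, (m.+1 <= n)%N ->
                 coef_on P ('X * P n) (n - m.+1)%N (- g q * (n ^_ m.+1)%:R) /\
                 - g q * (n ^_ m.+1)%:R != 0)]].
Proof.
move=> P h; split; [move=> n | exact: lower_bandwidth_finite_SV | move=> p q].
  rewrite eigenbasis_recurrence // big_ord_recl ffactn0 mulr1 subn0.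
  rewrite (big_addn 0 _ 1) subn1 big_mkord /= scalerBl opprD !addrA.
  by congr (_ - _); apply: eq_bigr => i _; rewrite addn1.
rewrite mulf_eq0 negb_or => /andP[gp gq] gpq.
have bounded : -1 <= p -> forall j, g j != 0 -> -1 <= j <= q.
  by move=> p1 j /gpq; lia.
split=> [p1 r bandr | p1 q1 | p1 m qm].
(* A finite band would put [g] in S^-1 K[S], contradicting [g p != 0] with p < -1. *)
- suff /in_SV_poly_ge/(_ p gp) : in_SV_poly g by lia.
  exact/(in_SV_poly_of_series (N := r.+1))/lower_bandedP.
(* Here q + 1 = 0, so h is the constant c_{-1}. *)
- have [|h0 hpos] := series_top_coef (q := q) (bounded p1); first by lia.
  have {}h0 : h 0%N = g (-1) by rewrite -q1 -h0 q1.
  have {}hpos k : (0 < k)%N -> h k = 0 by move=> k0; apply: hpos; rewrite q1.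
  split=> [|n]; first by apply: lower_bandwidthP => //; left.
  rewrite eigenbasis_recurrence // big_ord_recl big1 => [|i _].
    by rewrite -/h h0 ffactn0 mulr1 subn0 addr0 scalerBl addrA.
  by rewrite -/h hpos // mul0r scale0r.
have [|hq hpos] := series_top_coef (q := q) (bounded p1); first by lia.
have qm1 : `|(q + 1)%R|%N = m.+1 by lia.
rewrite {}qm1 -/h in hq hpos.
split=> [|n lemn]; first by apply: lower_bandwidthP => //; right; rewrite -/h hq.
split; last first.
  by rewrite mulNr oppr_eq0 mulf_neq0 // char0_natf_eq0 // -lt0n ffact_gt0.
(* The index n-m-1 is below n, so only the h-term of [recurrence_coef] survives, with h_{m+1} =
   c_q. *)
have -> : - g q * (n ^_ m.+1)%:R = recurrence_coef g n (n - m.+1)%N.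
  rewrite /recurrence_coef !ltn_eqF ?leq_subr; try lia.
  by rewrite subKn // -/h hq mul0r !add0r mulNr.
apply: coef_on_lincomb (mulX_eigenbasis K0 g n) _; [exact: size_eigenbasis | lia].
Qed.
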